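(* There is an absolute constant $c>0$ such that for all positive integers $f,l$ and every $N$ that is a positive multiple of $l^f$, there is an Ising instance on $N$ variables (with integer coefficients) whose graph $G$ has every vertex of degree at most $d=f(l-1)$, and which has at least $$2^{N\left(1-\frac{f\log_2(f\sqrt l/c)}{l}\right)}$$ global minima, every one of which is a $(2^f-1)$-minimum.
   Context: An Ising instance on $N$ variables is given by real numbers $h_i$ and $J_{ij}=J_{ji}$ ($i\neq j$), $J_{ii}=0$, and (up to an additive constant, which is irrelevant) defines $H(S)=\frac14\sum_ih_iS_i+\frac14\sum_{i<j}J_{ij}S_iS_j$ on $S\in\{-1,+1\}^N$. Its graph $G$ has vertices $1,\dots,N$ and an edge $\{i,j\}$ iff $J_{ij}\neq0$. A global minimum is an assignment minimizing $H$. For an integer $k\ge1$, an assignment $A$ is a $k$-minimum if every assignment differing from $A$ in at least one and at most $k$ variables has a strictly larger value of $H$. *)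

(* Defs.v *)
From Stdlib Require Import Reals ZArith.
From mathcomp Require Import all_boot.
Set Implicit Arguments. Unset Strict Implicit. Unset Printing Implicit Defensive.

Local Open Scope R_scope.
Definition spin (b : bool) : R := if b then 1 else (-1).

Definition assignment (N : nat) := {ffun 'I_N -> bool}.

Definition energy (N : nat) (h : 'I_N -> Z) (J : 'I_N -> 'I_N -> Z)
  (S : assignment N) : R :=
  (/4 * \big[Rplus/0]_(i : 'I_N) (IZR (h i) * spin (S i))
   + /4 * \big[Rplus/0]_(i : 'I_N) \big[Rplus/0]_(j : 'I_N | (i < j)%N)
          (IZR (J i j) * spin (S i) * spin (S j))).

Definition valid_couplings (N : nat) (J : 'I_N -> 'I_N -> Z) : Prop :=
  (forall i j, J i j = J j i) /\ (forall i, J i i = 0%Z).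

Definition degree (N : nat) (J : 'I_N -> 'I_N -> Z) (i : 'I_N) : nat :=
  #|[set j : 'I_N | ~~ Z.eqb (J i j) 0%Z]|.

Definition hdist (N : nat) (S T : assignment N) : nat :=
  #|[set i : 'I_N | S i != T i]|.

Definition global_min (N : nat) h J (S : assignment N) : Prop :=
  forall T : assignment N, (energy h J S <= energy h J T).

Definition global_minb (N : nat) h J (S : assignment N) : bool :=
  [forall T : assignment N, Rle_dec (energy h J S) (energy h J T)].

Definition k_min (N : nat) h J (k : nat) (S : assignment N) : Prop :=
  forall T : assignment N, (0 < hdist S T <= k)%N ->
    (energy h J S < energy h J T).

Definition log2 (x : R) : R := (ln x / ln 2).

(* Main.v *)
Require Import Defs.
From HB Require Import structures.
From Stdlib Require Import Reals ZArith Lra Lia.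
From mathcomp Require Import all_boot.
Set Implicit Arguments. Unset Strict Implicit. Unset Printing Implicit Defensive.

(** Put the variables on m copies of the grid [l]^f and let
    H(S) = sum over axis-parallel lines e of (X_e(S) - X_e(A))^2, where X_e is the
    sum of the spins on e. Up to a constant this is an Ising energy, and its minima
    are the assignments with the same line sums as A. Two of them that differ must
    differ at two points at least of any line through a difference, hence in at least 2^f points.
    To have many minima, take A in the largest fibre of S |-> X(S), of size M.
    With L = f N / l lines, E[sum_e X_e^2 / l] <= L, so Jensen gives
    2^N e^(-L) <= sum_S exp(- sum_e X_e(S)^2 / l), while grouping by fibres
    bounds this sum by M times (sum_x exp(- x^2 / l))^L <= M (2 sqrt l)^L. *)

Local Open Scope R_scope.

(** * Real sums and products as big operators; spins *)

Fact RplusA : associative Rplus. Proof. by move=> x y z; ring. Qed.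
Fact RmultA : associative Rmult. Proof. by move=> x y z; ring. Qed.
Fact RmultDl : left_distributive Rmult Rplus. Proof. by move=> x y z; ring. Qed.
Fact RmultDr : right_distributive Rmult Rplus. Proof. by move=> x y z; ring. Qed.

HB.instance Definition _ := Monoid.isComLaw.Build R 0 Rplus RplusA Rplus_comm Rplus_0_l.
HB.instance Definition _ := Monoid.isComLaw.Build R 1 Rmult RmultA Rmult_comm Rmult_1_l.
HB.instance Definition _ := Monoid.isMulLaw.Build R 0 Rmult Rmult_0_l Rmult_0_r.
HB.instance Definition _ := Monoid.isAddLaw.Build R Rmult Rplus RmultDl RmultDr.

Lemma Rsum_le (I : finType) (P : pred I) (F G : I -> R) :
  (forall i, P i -> F i <= G i) ->
  \big[Rplus/0]_(i | P i) F i <= \big[Rplus/0]_(i | P i) G i.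
Proof. by move=> FG; apply: (big_ind2 Rle); [lra | move=> *; lra |]. Qed.

Lemma Rsum_const (I : finType) (P : pred I) (x : R) :
  \big[Rplus/0]_(i | P i) x = INR #|[set i | P i]| * x.
Proof.
rewrite big_const cardsE; elim: #|_| => [|n IH]; first by rewrite /=; lra.
by rewrite iterS IH S_INR; lra.
Qed.

Lemma Rsum_opp (I : finType) (P : pred I) (F : I -> R) :
  \big[Rplus/0]_(i | P i) (- F i) = - \big[Rplus/0]_(i | P i) F i.
Proof. by rewrite (big_morph Ropp Ropp_plus_distr Ropp_0). Qed.

Lemma Rsum_ge0 (I : finType) (P : pred I) (F : I -> R) :
  (forall i, P i -> 0 <= F i) -> 0 <= \big[Rplus/0]_(i | P i) F i.
Proof. by move=> F0; apply: big_ind => //; [lra | move=> *; lra]. Qed.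

Lemma Rsum_sqr_eq0 (I : finType) (F : I -> R) :
  \big[Rplus/0]_(i : I) (F i) ^ 2 <= 0 -> forall i, F i = 0.
Proof.
pose G i := F i ^ 2; have G0 i : 0 <= G i by exact: pow2_ge_0.
move=> F0 i; have {F0} : \big[Rplus/0]_i G i <= 0 by [].
rewrite (bigD1 i) //= => F0.
have := @Rsum_ge0 _ (fun j => j != i) _ (fun j _ => G0 j) => ?.
apply: Rsqr_0_uniq; have := G0 i; rewrite (_ : Rsqr _ = G i); [lra | rewrite /G /Rsqr; ring].
Qed.

Lemma Rprod_le (I : finType) (F : I -> R) (x : R) :
  (forall i, 0 <= F i <= x) ->
  0 <= \big[Rmult/1]_(i : I) F i <= x ^ #|I|.
Proof.
move=> Fx; rewrite cardE -big_enum /=; elim: (enum I) => [|i s IH].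
  by rewrite big_nil /=; lra.
rewrite big_cons /=; case: (Fx i) => ? ?; case: IH => ? ?.
split; first exact: Rmult_le_pos.
exact: Rmult_le_compat.
Qed.

Lemma exp_sum (I : finType) (F : I -> R) :
  exp (\big[Rplus/0]_(i : I) F i) = \big[Rmult/1]_(i : I) exp (F i).
Proof. exact: (big_morph exp exp_plus exp_0). Qed.

(** The double sum splits into the diagonal and two triangles that agree by symmetry; the strict
    upper triangle is the form in which [energy] sums over pairs. *)
Lemma sqr_sum N (x : 'I_N -> R) :
  (\big[Rplus/0]_(i < N) x i) ^ 2 =
  \big[Rplus/0]_(i < N) x i ^ 2 +
  2 * \big[Rplus/0]_(i < N) \big[Rplus/0]_(j < N | (i < j)%N) (x i * x j).
Proof.
have -> : (\big[Rplus/0]_(i < N) x i) ^ 2 =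
    \big[Rplus/0]_(i < N) \big[Rplus/0]_(j < N) (x i * x j).
  by rewrite /= Rmult_1_r big_distrl; apply: eq_bigr => i _; rewrite big_distrr.
set U := \big[Rplus/0]_(i < N) \big[Rplus/0]_(j < N | (i < j)%N) (x i * x j).
have E : U = \big[Rplus/0]_(i < N) \big[Rplus/0]_(j < N | (j < i)%N) (x i * x j).
  rewrite /U (exchange_big_dep xpredT) //=.
  by apply: eq_bigr => i _; apply: eq_bigr => j _; rewrite Rmult_comm.
rewrite (_ : 2 * U = U + U); last by ring.
rewrite {2}E /U -!big_split /=; apply: eq_bigr => i _.
rewrite (bigD1 i) //= (bigID (fun j : 'I_N => (i < j)%N)) /=.
congr (_ + (_ + _)); first by ring.
  by apply: eq_bigl => j; rewrite -val_eqE /=; case: ltngtP.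
by apply: eq_bigl => j; rewrite -val_eqE /=; case: ltngtP.
Qed.

Lemma spin_sqr b : spin b ^ 2 = 1. Proof. by case: b; rewrite /spin; ring. Qed.

(** Integer spins, since the fields must take values in [Z]. *)
Definition spinZ (b : bool) : Z := if b then 1%Z else (-1)%Z.

Lemma IZR_spinZ b : IZR (spinZ b) = spin b. Proof. by case: b. Qed.

(** * Gaussian sums over points of spacing two *)

Lemma telescope_sum (u : nat -> R) n :
  \big[Rplus/0]_(k < n) (u k.+1 - u k) = u n - u 0%N.
Proof.
elim: n => [|n IH]; first by rewrite big_ord0; ring.
by rewrite big_ord_recr /= IH; ring.
Qed.

Lemma exp_neg_le y : 0 <= y -> exp (- y) <= / (1 + y).
Proof.
move=> y0; rewrite exp_Ropp; apply: Rinv_le_contravar; first lra.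
exact: exp_ineq1_le.
Qed.

Lemma exp_INR_le n : exp (INR n) <= 3 ^ n.
Proof.
elim: n => [|n IH]; first by rewrite exp_0 /=; lra.
rewrite S_INR exp_plus Rmult_comm; apply: Rmult_le_compat => //; try (by left; exact: exp_pos).
exact: exp_le_3.
Qed.

(* Its increments dominate the Gaussian weights, which bounds their sum by a telescoping one. *)
Definition squash (r x : R) : R := x / (r + Rabs x).

Lemma squash_bound r x : 0 < r -> -1 <= squash r x <= 1.
Proof.
move=> r0; rewrite /squash; have x0 := Rabs_pos x.
have d0 : 0 < r + Rabs x by lra.
have [x1 x2] : - Rabs x <= x <= Rabs x.
  by split; move: (Rle_abs x) (Rle_abs (- x)); rewrite Rabs_Ropp; lra.
split; [apply: (Rmult_le_reg_r (r + Rabs x)) | apply: (Rmult_le_reg_r (r + Rabs x))] => //;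
  rewrite /Rdiv Rmult_assoc Rinv_l; lra.
Qed.

Lemma squashN r x : squash r (- x) = - squash r x.
Proof. by rewrite /squash Rabs_Ropp /Rdiv; ring. Qed.

(** For x >= 1 the right side equals 2 r^2 / ((r + x)^2 - 1), and exp(-t) <= 1 / (1 + t) with (r +
    x)^2 <= 2 (r^2 + x^2) suffices; negative x follow by oddness. The condition on x holds at every
    integer, and ensures that x - 1 and x + 1 have opposite signs only at x = 0. *)
Lemma gauss_le_squash r x : 1 <= r -> x <= -1 \/ x = 0 \/ 1 <= x ->
  exp (- (x ^ 2 / r ^ 2)) <= r * (squash r (x + 1) - squash r (x - 1)).
Proof.
move=> r1.
have rr : 0 < r ^ 2 by apply: pow_lt; lra.
have pos y : 1 <= y -> exp (- (y ^ 2 / r ^ 2)) <= r * (squash r (y + 1) - squash r (y - 1)).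
  move=> y1; have yy : 0 <= y ^ 2 by exact: pow2_ge_0.
  apply: Rle_trans (exp_neg_le _) _.
    by apply: Rmult_le_pos => //; left; exact: Rinv_0_lt_compat.
  rewrite /squash !Rabs_pos_eq; [|lra|lra].
  have -> : / (1 + y ^ 2 / r ^ 2) = r ^ 2 / (r ^ 2 + y ^ 2) by field; split; nra.
  have -> : r * ((y + 1) / (r + (y + 1)) - (y - 1) / (r + (y - 1))) =
      r ^ 2 * (2 / ((r + y) ^ 2 - 1)) by field; repeat split; nra.
  apply: Rmult_le_compat_l; first lra.
  have -> : / (r ^ 2 + y ^ 2) = 2 / (2 * (r ^ 2 + y ^ 2)) by field; nra.
  apply: Rmult_le_compat_l; first lra.
  apply: Rinv_le_contravar; first nra.
  by have := pow2_ge_0 (r - y); nra.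
case=> [x1|[->|x1]]; last exact: pos.
  have /pos : 1 <= - x by lra.
  rewrite (_ : - x + 1 = - (x - 1)); last by ring.
  rewrite (_ : - x - 1 = - (x + 1)); last by ring.
  rewrite !squashN (_ : (- x) ^ 2 = x ^ 2); last by ring.
  by move=> H; apply: Rle_trans H _; lra.
rewrite (_ : - (0 ^ 2 / r ^ 2) = 0); last by field; lra.
rewrite exp_0 (_ : 0 - 1 = - (0 + 1)); last by ring.
rewrite squashN /squash Rabs_pos_eq; last lra.
apply: (Rmult_le_reg_r (r + (0 + 1))); first lra.
by rewrite (_ : r * _ * _ = 2 * r); [lra | field; lra].
Qed.

Lemma gauss_sum_le (l n : nat) : (0 < l)%N ->
  \big[Rplus/0]_(k < l.+1) exp (- ((2 * INR k - INR n) ^ 2 / INR l)) <= 2 * sqrt (INR l).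
Proof.
move=> l0; have l1 : 1 <= INR l by rewrite -[1]/(INR 1); apply: le_INR; apply/leP.
set r := sqrt (INR l).
have r1 : 1 <= r by rewrite -sqrt_1; apply: sqrt_le_1; lra.
have rl : r ^ 2 = INR l by rewrite /= Rmult_1_r sqrt_sqrt; lra.
(* The values x = 2k - n have spacing 2, so x + 1 for k is x - 1 for k + 1 and the increments
   telescope. *)
pose u k := r * squash r (2 * INR k - INR n - 1).
apply: Rle_trans (_ : u l.+1 - u 0%N <= _); last first.
  have := @squash_bound r (2 * INR l.+1 - INR n - 1).
  have := @squash_bound r (2 * INR 0 - INR n - 1).
  by rewrite /u; nra.
rewrite -telescope_sum; apply: Rsum_le => k _.
rewrite -rl /u S_INR -Rmult_minus_distr_l.
rewrite (_ : 2 * (INR k + 1) - INR n - 1 = 2 * INR k - INR n + 1); last by ring.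
apply: gauss_le_squash => //.
rewrite !INR_IZR_INZ -mult_IZR -minus_IZR.
set z := (_ - _)%Z.
have [|[->|]] : (z <= -1 \/ z = 0 \/ 1 <= z)%Z by lia.
- by move/IZR_le; left.
- by right; left.
- by move/IZR_le; right; right.
Qed.

(** * Averages over all assignments *)

Lemma card_assignment N : INR #|{: assignment N}| = 2 ^ N.
Proof.
rewrite card_ffun card_bool card_ord; elim: N => [|N IH] //.
by rewrite expnS mult_INR IH.
Qed.

Definition flip N (i : 'I_N) (S : assignment N) : assignment N :=
  [ffun k => if k == i then ~~ S k else S k].

Lemma flipK N (i : 'I_N) : involutive (flip i).
Proof. by move=> S; apply/ffunP => k; rewrite !ffunE; case: (k == i); rewrite ?negbK. Qed.

(** Flipping the spin at [i] permutes the assignments and negates the product. *)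
Lemma sum_spin_prod N (i j : 'I_N) : i != j ->
  \big[Rplus/0]_(S : assignment N) (spin (S i) * spin (S j)) = 0.
Proof.
move=> ij; set E := LHS; suff : E = - E by lra.
rewrite {1}/E (reindex_inj (inv_inj (flipK i))) /= /E -Rsum_opp.
apply: eq_bigr => S _; rewrite !ffunE eqxx eq_sym (negbTE ij).
by case: (S i); rewrite /spin /=; ring.
Qed.

(** * The Ising energy attached to a family of lines *)

Section Lines.
Variables (N : nat) (L : finType) (inc : 'I_N -> L -> bool).
Implicit Types (S T A : assignment N) (e : L).

Definition line_sum S e : R := \big[Rplus/0]_(i < N | inc i e) spin (S i).

(** Each line through both points contributes 2 S_i S_j to the sum of squares; the factor 1/4 in
    [energy] turns 2 into 8. *)
Definition line_coupling (i j : 'I_N) : Z :=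
  if i == j then 0%Z else Z.of_nat (8 * #|[set e | inc i e && inc j e]|).

(** The cross terms -2 X_e(S) X_e(A), again multiplied by 4. *)
Definition line_field A (i : 'I_N) : Z :=
  (-8 * \big[Z.add/0%Z]_(e | inc i e) \big[Z.add/0%Z]_(j < N | inc j e) spinZ (A j))%Z.

Definition discrepancy A S : R :=
  \big[Rplus/0]_(e : L) (line_sum S e - line_sum A e) ^ 2.

Lemma line_coupling_valid : valid_couplings line_coupling.
Proof.
split=> [i j|i]; rewrite /line_coupling ?eqxx // eq_sym; case: ifP => // _.
by congr (Z.of_nat (8 * _)); apply: eq_card => e; rewrite !inE andbC.
Qed.

Lemma IZR_line_field A i :
  IZR (line_field A i) = -8 * \big[Rplus/0]_(e | inc i e) line_sum A e.
Proof.
rewrite /line_field mult_IZR (big_morph IZR plus_IZR (erefl (IZR 0))).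
congr (_ * _); apply: eq_bigr => e _; rewrite (big_morph IZR plus_IZR (erefl (IZR 0))).
by apply: eq_bigr => j _; exact: IZR_spinZ.
Qed.

Lemma discrepancy_energy A : exists C, forall S,
  discrepancy A S = energy (line_field A) line_coupling S + C.
Proof.
(* The constant collects the squares S_i^2 = 1, one for each point of each line, and the squares
   X_e(A)^2. *)
exists (\big[Rplus/0]_(e : L) (INR #|[set i | inc i e]| + line_sum A e ^ 2)) => S.
(* Spins off the line are replaced by 0, so that all lines share one index set of pairs and the sums
   can be exchanged. *)
pose U := \big[Rplus/0]_(e : L) (2 * \big[Rplus/0]_(i < N) \big[Rplus/0]_(j < N | (i < j)%N)
            ((if inc i e then spin (S i) else 0) * (if inc j e then spin (S j) else 0))).
pose V := \big[Rplus/0]_(e : L) (-2 * line_sum A e * line_sum S e).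
have -> : discrepancy A S = V + U +
    \big[Rplus/0]_(e : L) (INR #|[set i | inc i e]| + line_sum A e ^ 2).
  rewrite /discrepancy /V /U -!big_split /=; apply: eq_bigr => e _.
  set B := line_sum A e; set W := 2 * _.
  have -> : INR #|[set i | inc i e]| = line_sum S e ^ 2 - W.
    rewrite /line_sum (big_mkcond (fun i => inc i e)) sqr_sum -/W.
    rewrite Rplus_minus_r -(Rmult_1_r (INR _)) -Rsum_const [in LHS]big_mkcond.
    by apply: eq_bigr => i _; case: ifP => _; [rewrite spin_sqr | ring].
  by ring.
congr (_ + _); rewrite /energy; congr (_ + _).
  rewrite /V big_distrr /=.
  under eq_bigr => e _ do rewrite /(line_sum S) big_distrr /=.
  rewrite (exchange_big_dep xpredT) //=; apply: eq_bigr => i _.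
  rewrite IZR_line_field -big_distrl -big_distrr /=; field.
rewrite /U -big_distrr /= exchange_big /= !big_distrr /=; apply: eq_bigr => i _.
rewrite exchange_big /= !big_distrr /=; apply: eq_bigr => j ij.
rewrite /line_coupling ifF; last by apply/negP => /eqP ?; subst j; rewrite ltnn in ij.
rewrite -INR_IZR_INZ mult_INR (_ : INR 8 = 8); last by rewrite /=; ring.
(* For a fixed pair, the sum over [e] counts the lines through both points. *)
rewrite (eq_bigr (fun e => if inc i e && inc j e then spin (S i) * spin (S j) else 0)).
  by rewrite -big_mkcond Rsum_const; field.
by move=> e _; case: (inc i e); case: (inc j e); rewrite /=; ring.
Qed.

(** The discrepancy is nonnegative and vanishes at [A], so its minima are its zeros. *)
Lemma global_min_line_sum A S :
  global_min (line_field A) line_coupling S <-> line_sum S =1 line_sum A.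
Proof.
have [C CE] := discrepancy_energy A.
have A0 : discrepancy A A = 0.
  by rewrite /discrepancy big1 // => e _; ring.
split=> [Smin e|SA T].
  have S0 : discrepancy A S <= 0 by move: (Smin A) (CE A) (CE S); lra.
  by move: (Rsum_sqr_eq0 S0 e) => /= ?; lra.
have S0 : discrepancy A S = 0.
  by rewrite /discrepancy big1 // => e _; rewrite SA; ring.
have T0 : 0 <= discrepancy A T.
  by apply: Rsum_ge0 => e _; exact: pow2_ge_0.
by move: (CE T) (CE S); lra.
Qed.

(** An assignment with no more energy than [S] is itself a global minimum, so it shares the line
    sums of [S] and lies beyond distance [k] unless it equals [S]. *)
Lemma k_min_line_sum A S k :
  (forall T, line_sum T =1 line_sum S -> (0 < hdist S T)%N -> (k < hdist S T)%N) ->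
  global_min (line_field A) line_coupling S ->
  k_min (line_field A) line_coupling k S.
Proof.
move=> far Smin T /andP[dT Tk]; set E := energy (line_field A) line_coupling.
have [//|TS] := Rlt_le_dec (E S) (E T).
have /global_min_line_sum TA : global_min (line_field A) line_coupling T.
  by move=> T'; apply: Rle_trans TS (Smin T').
have /global_min_line_sum SA := Smin.
by have := far T (fun e => etrans (TA e) (esym (SA e))) dT; rewrite ltnNge Tk.
Qed.

Lemma line_sumE S e :
  line_sum S e = 2 * INR #|[set i | inc i e && S i]| - INR #|[set i | inc i e]|.
Proof.
rewrite -(Rmult_1_r (INR #|[set i | inc i e && S i]|)).
rewrite -(Rmult_1_r (INR #|[set i | inc i e]|)) -!Rsum_const.
rewrite big_mkcondr big_distrr /= /Rminus -Rsum_opp -big_split /=.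
by apply: eq_bigr => i _; case: (S i); rewrite /spin; ring.
Qed.

(** Distinct spins are uncorrelated, so only the diagonal of the expanded square survives. *)
Lemma line_sum_second_moment e :
  \big[Rplus/0]_(S : assignment N) line_sum S e ^ 2 =
  2 ^ N * INR #|[set i | inc i e]|.
Proof.
transitivity (\big[Rplus/0]_(i < N | inc i e) \big[Rplus/0]_(j < N | inc j e)
    \big[Rplus/0]_(S : assignment N) (spin (S i) * spin (S j))).
  under [RHS]eq_bigr => i _ do rewrite exchange_big /=.
  rewrite exchange_big; apply: eq_bigr => S _.
  rewrite /line_sum (_ : forall x, x ^ 2 = x * x); last by move=> x; ring.
  by rewrite big_distrl; apply: eq_bigr => i _; rewrite big_distrr.
rewrite Rmult_comm -Rsum_const; apply: eq_bigr => i ie.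
rewrite (bigD1 i) //= (eq_bigr (fun _ : assignment N => 1)); last first.
  by move=> S _; case: (S i); rewrite /spin; ring.
rewrite Rsum_const cardsE card_assignment big1 ?Rplus_0_r ?Rmult_1_r //.
by move=> j /andP[_ ji]; apply: sum_spin_prod; rewrite eq_sym.
Qed.

(** * A popular vector of line sums *)

Section Counting.
Variable l : nat.
Hypothesis l_gt0 : (0 < l)%N.
Hypothesis card_line : forall e, (#|[set i | inc i e]| <= l)%N.

(** The sum of X_e^2 / l has mean at most [#|L|], since each line contributes its size divided by
    [l]. *)
Lemma gauss_weight_lower :
  2 ^ N * exp (- INR #|L|) <= \big[Rplus/0]_(S : assignment N)
    \big[Rmult/1]_(e : L) exp (- (line_sum S e ^ 2 / INR l)).
Proof.
have l0 : 0 < INR l by apply: lt_0_INR; apply/ltP.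
pose Y S := \big[Rplus/0]_(e : L) (line_sum S e ^ 2 / INR l).
have Ymean : \big[Rplus/0]_(S : assignment N) Y S <= 2 ^ N * INR #|L|.
  rewrite /Y exchange_big /= Rmult_comm -[#|L|]cardsT -Rsum_const.
  apply: Rsum_le => e _; rewrite -big_distrl /= line_sum_second_moment.
  rewrite -[X in _ <= X]Rmult_1_r Rmult_assoc; apply: Rmult_le_compat_l.
    by apply: pow_le; lra.
  apply: (Rmult_le_reg_r (INR l)) => //; rewrite Rmult_assoc Rinv_l; last lra.
  by rewrite Rmult_1_r Rmult_1_l; apply: le_INR; apply/leP.
(* The bound on the mean of [Y] says that the linear factors 1 + [#|L|] - [Y] average to at least
   1. *)
have Yle : 2 ^ N <= 2 ^ N * (1 + INR #|L|) + - \big[Rplus/0]_(S : assignment N) Y S by lra.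
(* Jensen: the tangent line of exp at - #|L| *)
apply: Rle_trans (_ : \big[Rplus/0]_(S : assignment N)
    (exp (- INR #|L|) * (1 + INR #|L| + - Y S)) <= _).
  rewrite -big_distrr big_split /= Rsum_opp Rsum_const cardsE card_assignment.
  rewrite Rmult_comm; apply: Rmult_le_compat_l; first by left; exact: exp_pos.
  exact: Yle.
apply: Rsum_le => S _; rewrite -exp_sum Rsum_opp -/(Y S).
rewrite [X in _ <= exp X](_ : _ = - INR #|L| + (INR #|L| + - Y S)); last by ring.
rewrite exp_plus; apply: Rmult_le_compat_l; first by left; exact: exp_pos.
by rewrite Rplus_assoc; exact: exp_ineq1_le.
Qed.

(** Line sums encoded by the number of plus spins, so that the fibres are indexed by a finite type;
    [inord] loses nothing because a line has at most [l] points. *)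
Definition line_counts S : {ffun L -> 'I_l.+1} :=
  [ffun e => inord #|[set i | inc i e && S i]|].

Lemma line_countsE S e : line_counts S e = #|[set i | inc i e && S i]| :> nat.
Proof.
rewrite ffunE inordK // ltnS; apply: leq_trans (card_line e).
by apply: subset_leq_card; apply/subsetP => i; rewrite !inE => /andP[].
Qed.

Lemma eq_line_counts S T : line_counts S = line_counts T -> line_sum S =1 line_sum T.
Proof. by move=> ST e; rewrite !line_sumE -!line_countsE ST. Qed.

Lemma popular_line_sums : exists A,
  2 ^ N <= (6 * sqrt (INR l)) ^ #|L| *
    INR #|[set S : assignment N | line_counts S == line_counts A]|.
Proof.
pose F k := #|[set S | line_counts S == k]|.
(* The constant assignment only supplies the inhabitant that the maximum needs; [k] indexes a
   largest fibre. *)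
have [k _ kmax] := @arg_maxnP _ (line_counts [ffun=> true]) xpredT F erefl.
pose w (k : {ffun L -> 'I_l.+1}) := \big[Rmult/1]_(e : L)
  exp (- ((2 * INR (k e) - INR #|[set i | inc i e]|) ^ 2 / INR l)).
have w0 k' : 0 <= w k'.
  by apply: big_ind => [|x y ? ?|e _]; [lra | exact: Rmult_le_pos | left; exact: exp_pos].
have upper : 2 ^ N * exp (- INR #|L|) <= INR (F k) * (2 * sqrt (INR l)) ^ #|L|.
  apply: Rle_trans gauss_weight_lower _.
  rewrite (eq_bigr (fun S => w (line_counts S))); last first.
    by move=> S _; apply: eq_bigr => e _; rewrite line_sumE line_countsE.
  rewrite (partition_big line_counts xpredT) //=.
  apply: Rle_trans (_ : \big[Rplus/0]_k' (INR (F k) * w k') <= _).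
    apply: Rsum_le => k' _; rewrite (eq_bigr (fun=> w k')); last by move=> S /eqP->.
    rewrite Rsum_const; apply: Rmult_le_compat_r => //.
    by apply: le_INR; apply/leP; exact: kmax.
  rewrite -big_distrr /w /=; apply: Rmult_le_compat_l; first exact: pos_INR.
  (* The sum over all vectors of counts factors into one Gaussian sum per line. *)
  rewrite -(bigA_distr_bigA (fun e (k : 'I_l.+1) =>
    exp (- ((2 * INR k - INR #|[set i | inc i e]|) ^ 2 / INR l)))).
  apply: (proj2 (Rprod_le _)) => e; split; last exact: gauss_sum_le.
  by apply: Rsum_ge0 => j _; left; exact: exp_pos.
have bound : 2 ^ N <= (6 * sqrt (INR l)) ^ #|L| * INR (F k).
  have e0 := exp_pos (INR #|L|).
  apply: (Rmult_le_reg_r (exp (- INR #|L|))); first exact: exp_pos.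
  apply: Rle_trans upper _.
  (* In the constant 6, the 2 comes from the Gaussian sum and the 3 absorbs the factor e per
     line. *)
  rewrite (_ : 6 * sqrt _ = 3 * (2 * sqrt (INR l))); last by ring.
  rewrite (Rpow_mult_distr 3); set q := (2 * _) ^ _.
  have q0 : 0 <= q by apply: pow_le; have := sqrt_pos (INR l); lra.
  have e3 : 1 <= 3 ^ #|L| * exp (- INR #|L|).
    rewrite exp_Ropp; apply: (Rmult_le_reg_r (exp (INR #|L|))) => //.
    rewrite Rmult_assoc Rinv_l ?Rmult_1_l ?Rmult_1_r; last lra.
    exact: exp_INR_le.
  rewrite -[X in X <= _]Rmult_1_l (_ : _ * _ * _ = 3 ^ #|L| * exp (- INR #|L|) * (INR (F k) * q)).
    by apply: Rmult_le_compat_r => //; apply: Rmult_le_pos => //; exact: pos_INR.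
  by ring.
(* The largest fibre is nonempty, as otherwise [bound] would give 2^N <= 0; any member serves as
   [A]. *)
have [Fk0|] := posnP (F k).
  have : 0 < 2 ^ N by apply: pow_lt; lra.
  by move: bound; rewrite Fk0 Rmult_0_r; lra.
by case/card_gt0P => A; rewrite inE => /eqP kA; exists A; rewrite kA.
Qed.

End Counting.

End Lines.

(** * Sets that spread in every direction *)

(** Cut [D] by whether coordinate [k] agrees with that of [v]: both parts are nonempty, and moves in
    the other directions preserve coordinate [k], so induction applies to each part and the bound
    doubles. *)
Lemma card_spread_set (V K : finType) (C : eqType) (c : K -> V -> C) (s : seq K) (D : {set V}) :
  uniq s -> D != set0 ->
  (forall v k, v \in D -> k \in s -> exists w,
    [/\ w \in D, c k w != c k v & forall k', k' != k -> c k' w = c k' v]) ->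
  (2 ^ size s <= #|D|)%N.
Proof.
elim: s D => [|k s IH] D /=; first by rewrite card_gt0.
case/andP=> ks us /set0Pn[v vD] spread.
have [w [wD wv _]] := spread v k vD (mem_head _ _).
pose E := [set u | c k u == c k v].
have slice (B : {set V}) : (forall u u', c k u = c k u' -> (u \in B) = (u' \in B)) ->
    D :&: B != set0 -> (2 ^ size s <= #|D :&: B|)%N.
  move=> Bk DB; apply: IH => // u k' /setIP[uD uB] k's.
  have [|u' [u'D u'u off]] := spread u k' uD; first by rewrite in_cons k's orbT.
  exists u'; split=> //; rewrite inE u'D (Bk u' u) //; apply: off.
  by apply: contraNneq ks => ->.
rewrite expnS mul2n -addnn -(cardsID E) leq_add //.
  by apply: slice => [u u' uu'|]; [rewrite !inE uu' | apply/set0Pn; exists v; rewrite !inE vD eqxx].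
rewrite setDE; apply: slice => [u u' uu'|]; first by rewrite !inE uu'.
by apply/set0Pn; exists w; rewrite !inE wD wv.
Qed.

(** * Copies of the grid and their lines *)

Section Grid.
Variables (f m l N : nat).
(** The dimension is [f.+1], so that the coordinates off one direction are indexed by ['I_f]. *)
Definition grid_point := ('I_m * {ffun 'I_f.+1 -> 'I_l})%type.
Definition grid_line := ('I_f.+1 * ('I_m * {ffun 'I_f -> 'I_l}))%type.
Implicit Types (v w : grid_point) (a : 'I_f.+1) (e : grid_line).

(* A line is a direction, a copy of the grid, and the coordinates off that direction. *)
Definition line_through a v : grid_line := (a, (v.1, [ffun b => v.2 (lift a b)])).

Lemma line_through_eq a v w : line_through a v = line_through a w ->
  v.1 = w.1 /\ forall b, b != a -> v.2 b = w.2 b.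
Proof.
case=> vw1 /ffunP vw2; split=> // b; case: (unliftP a b) => [b' -> _|->]; last by rewrite eqxx.
by have := vw2 b'; rewrite !ffunE.
Qed.

Lemma line_through_inj a v w : line_through a v = line_through a w ->
  v.2 a = w.2 a -> v = w.
Proof.
case: v w => [v1 v2] [w1 w2] /line_through_eq /= [-> vw] vwa; congr (_, _).
by apply/ffunP => b; have [->|/vw] := eqVneq b a.
Qed.

Variable pos : 'I_N -> grid_point.
Hypothesis pos_inj : injective pos.

Definition on_line (i : 'I_N) e : bool := line_through e.1 (pos i) == e.

Lemma on_line_through i a : on_line i (line_through a (pos i)).
Proof. exact: eqxx. Qed.

(** A point of a line is determined by its coordinate along the line. *)
Lemma card_on_line e : (#|[set i | on_line i e]| <= l)%N.
Proof.
rewrite -[leqRHS]card_ord -(@card_in_imset _ _ (fun i => (pos i).2 e.1)); first exact: max_card.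
move=> i j; rewrite !inE => /eqP ie /eqP je ij; apply: pos_inj.
by apply: line_through_inj ij; rewrite ie je.
Qed.

(** A neighbour shares a line with [i]; there is one line through [i] per direction, with at most
    [l - 1] other points. *)
Lemma grid_degree i : (degree (line_coupling on_line) i <= f.+1 * (l - 1))%N.
Proof.
apply: leq_trans (_ : #|\bigcup_a ([set j | on_line j (line_through a (pos i))] :\ i)| <= _)%N.
  apply: subset_leq_card; apply/subsetP => j; rewrite inE /line_coupling.
  have [//|ij] := eqVneq i j => Jij.
  have /card_gt0P[e] : (0 < #|[set e | on_line i e && on_line j e]|)%N.
    by rewrite lt0n; apply: contraNneq Jij => ->.
  rewrite inE => /andP[/eqP ie je]; apply/bigcupP; exists e.1 => //.
  by rewrite !inE eq_sym ij ie.
apply: leq_trans (_ : \sum_(a < f.+1) (l - 1) <= _)%N; last by rewrite sum_nat_const card_ord.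
apply: (big_ind2 (fun (A : {set 'I_N}) n => #|A| <= n)%N) => [|A1 n1 A2 n2 A1n A2n|a _].
- by rewrite cards0.
- by apply: leq_trans (leq_card_setU _ _) _; exact: leq_add.
have := card_on_line (line_through a (pos i)).
by rewrite (cardsD1 i) inE on_line_through add1n subn1; case: l => // l'; rewrite ltnS.
Qed.

(** The set of differences spreads in every direction: a single difference on a line would change
    its sum. *)
Lemma hdist_line_sum (S T : assignment N) :
  line_sum on_line S =1 line_sum on_line T -> (0 < hdist S T)%N -> (2 ^ f.+1 <= hdist S T)%N.
Proof.
move=> ST ST0; rewrite -[f.+1 in X in (X <= _)%N]size_enum_ord.
apply: (@card_spread_set _ _ _ (fun a (i : 'I_N) => (pos i).2 a)); first exact: enum_uniq.
  by rewrite -card_gt0.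
move=> i a; rewrite inE => SiTi _; set e := line_through a (pos i).
have [j /and3P[ji je SjTj]|agree] := pickP [pred j | [&& j != i, on_line j e & S j != T j]].
  have /line_through_eq[_ off] : line_through a (pos j) = line_through a (pos i) by exact/eqP.
  exists j; split=> //; first by rewrite inE.
  apply: contraNneq ji => jia; apply/eqP/pos_inj.
  by apply: (line_through_inj (a := a)) => //; exact/eqP.
(* If [i] is the only difference on [e], cancelling the other spins leaves equal spins at [i], a
   contradiction. *)
have := ST e; rewrite /line_sum (bigD1 i) ?on_line_through //= [RHS](bigD1 i) ?on_line_through //=.
rewrite (eq_bigr (fun j => spin (T j))) => [|j /andP[je ji]]; last first.
  by have /negbT := agree j; rewrite /= ji je /= negbK => /eqP->.
by move: SiTi; case: (S i) (T i) => -[] //= _; rewrite /spin; lra.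
Qed.

End Grid.

(** * The exponent and the final construction *)

(** Since L = f N / l, the left side is 2^N / P^L with P = 6 f sqrt(l), and P >= 6 sqrt(l). *)
Lemma Rpower_count_le (N f l L : nat) (M : R) : (0 < f)%N -> (0 < l)%N ->
  (L * l = f * N)%N -> 0 <= M -> 2 ^ N <= (6 * sqrt (INR l)) ^ L * M ->
  Rpower 2 (INR N * (1 - INR f * log2 (INR f * sqrt (INR l) / / 6) / INR l)) <= M.
Proof.
move=> f0 l0 Ll M0 NM.
have f1 : 1 <= INR f by rewrite -[1]/(INR 1); apply: le_INR; apply/leP.
have l1 : 0 < INR l by apply: lt_0_INR; apply/ltP.
have s0 : 0 < sqrt (INR l) by exact: sqrt_lt_R0.
set P := INR f * sqrt _ / _.
have PE : P = INR f * (6 * sqrt (INR l)) by rewrite /P; field.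
have qP : 6 * sqrt (INR l) <= P by rewrite PE; nra.
have P0 : 0 < P by lra.
have ln2 : 0 < ln 2 by rewrite -ln_1; apply: ln_increasing; lra.
have {}Ll : INR L * INR l = INR f * INR N by rewrite -!mult_INR; congr INR; exact: Ll.
rewrite /Rpower /log2.
have -> : INR N * (1 - INR f * (ln P / ln 2) / INR l) * ln 2 = INR N * ln 2 + - (INR L * ln P).
  have -> : INR L = INR f * INR N / INR l by rewrite -Ll; field; lra.
  by field; lra.
rewrite exp_plus exp_Ropp -/(Rpower 2 (INR N)) -/(Rpower P (INR L)) !Rpower_pow //; last lra.
have PL : 0 < P ^ L by exact: pow_lt.
apply: (Rmult_le_reg_r (P ^ L)) => //; rewrite Rmult_assoc Rinv_l; last lra.
rewrite Rmult_1_r Rmult_comm; apply: Rle_trans NM _.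
by apply: Rmult_le_compat_r => //; apply: pow_incr; lra.
Qed.

Theorem mainTheorem6 :
  exists c : R, (0 < c) /\
  forall f l N : nat, (0 < f)%N -> (0 < l)%N ->
    (exists m : nat, (0 < m)%N /\ N = (m * l ^ f)%N) ->
    exists (h : 'I_N -> Z) (J : 'I_N -> 'I_N -> Z),
      valid_couplings J /\
      (forall i : 'I_N, (degree J i <= f * (l - 1))%N) /\
      (Rpower 2 (INR N * (1 - INR f * log2 (INR f * sqrt (INR l) / c) / INR l))
         <= INR #|[set S : assignment N | global_minb h J S]|) /\
      (forall S : assignment N, global_min h J S -> k_min h J (2 ^ f - 1) S).
Proof.
(* The value c = 1/6 matches the factor 6 sqrt(l) per line in [popular_line_sums]. *)
exists (/ 6); split=> [|[//|f] l N _ l0 [m [_ NE]]]; first lra.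
have cardV : N = #|{: grid_point f m l}| by rewrite card_prod card_ffun !card_ord.
pose pos i : grid_point f m l := enum_val (cast_ord cardV i).
have pos_inj : injective pos by move=> i j /enum_val_inj /cast_ord_inj.
pose inc := on_line pos.
have inc_le e : (#|[set i | inc i e]| <= l)%N by exact: card_on_line.
have [A popular] := popular_line_sums l0 inc_le.
exists (line_field inc A), (line_coupling inc); split; first exact: line_coupling_valid.
split; first exact: grid_degree.
split; last first.
  move=> S; apply: k_min_line_sum => T TS ST0.
  have := hdist_line_sum pos_inj (fun e => esym (TS e)) ST0.
  by apply: leq_trans; rewrite subn1 prednK ?expn_gt0.
apply: (@Rpower_count_le _ _ _ #|{: grid_line f m l}|).
- by [].
- by [].
(* Double count of incidences: each line has [l] grid points and each grid point lies on one line
   per direction. *)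
- by rewrite NE /grid_line !card_prod card_ffun !card_ord expnSr -!mulnA.
- exact: pos_INR.
(* The fibre of [A] consists of global minima, so its size bounds their number from below. *)
apply: Rle_trans popular _; apply: Rmult_le_compat_l.
  by apply: pow_le; have := sqrt_pos (INR l); lra.
apply: le_INR; apply/leP; apply: subset_leq_card; apply/subsetP => S; rewrite !inE => /eqP SA.
have /global_min_line_sum Smin : line_sum inc S =1 line_sum inc A by exact: eq_line_counts SA.
by apply/forallP => T; case: Rle_dec => // nle; case: nle; exact: Smin.
Qed.
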